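(* Let $A\in\mathbb{R}^{n_x\times n_x}$, $B\in\mathbb{R}^{n_x\times n_u}$, $B_w\in\mathbb{R}^{n_x\times n_w}$, $C\in\mathbb{R}^{n_y\times n_x}$, $Q\in\mathbb{R}^{n_x\times n_x}$, $R\in\mathbb{R}^{n_u\times n_u}$ satisfy the standing assumptions given in the context, and let $\mathcal{K}$ and $J:\mathcal{K}\to\mathbb{R}_+$ be the associated stabilizing set and $\mathcal{H}_\infty$ cost. Let $\nu>0$ be such that the sublevel set $\mathcal{K}_\nu:=\{K\in\mathcal{K}\mid J(K)\le\nu\}$ is nonempty. Then, for any nonempty convex subset $V\subset\mathcal{K}_\nu$, there exists a constant $m_\nu>0$ (depending on $\nu$ and the problem data but not on $V$) such that the function $$K\;\mapsto\;J(K)+\tfrac{m_\nu}{2}\|K\|_F^2$$ is convex over $V$.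
   Context: Standing assumptions: $(A,B)$ is stabilizable; $B_w$ and $C$ have full row rank; $Q$ and $R$ are (symmetric) positive definite; and the set of stabilizing static output-feedback gains $$\mathcal{K}:=\{K\in\mathbb{R}^{n_u\times n_y}\mid\rho(A+BKC)<1\}$$ is nonempty, where $\rho(\cdot)$ denotes the spectral radius of a matrix. For $K\in\mathcal{K}$ and $\omega\in[0,2\pi]$, define the $(n_x+n_u)\times n_w$ complex matrix $$\mathbf{T}_{zw}(K,\omega)=\begin{bmatrix}Q^{1/2}\\ R^{1/2}KC\end{bmatrix}\left(e^{j\omega}I-(A+BKC)\right)^{-1}B_w,$$ with $j$ the imaginary unit, and the $\mathcal{H}_\infty$ cost $$J(K):=\|\mathbf{T}_{zw}(K)\|_{\mathcal{H}_\infty}=\max_{\omega\in[0,2\pi]}\sigma_{\max}(\mathbf{T}_{zw}(K,\omega)),$$ where $\sigma_{\max}$ is the largest singular value. $\|\cdot\|_F$ is the Frobenius norm. *)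

(* Defs.v *)
From HB Require Import structures.
From mathcomp Require Import all_boot all_order all_algebra.
From mathcomp Require Import all_classical all_reals all_analysis.
From mathcomp Require Import complex.

Set Implicit Arguments.
Unset Strict Implicit.
Unset Printing Implicit Defensive.

Import Order.TTheory GRing.Theory Num.Theory.

Local Open Scope classical_set_scope.
Local Open Scope ring_scope.
Local Open Scope sesquilinear_scope.
Local Open Scope complex_scope.

Definition cmx (F : realType) (m n : nat) (M : 'M[F]_(m, n)) : 'M[F[i]]_(m, n) :=
  map_mx (fun x : F => x%:C) M.

Definition posdefmx (F : realType) (n : nat) (M : 'M[F]_n) : Prop :=
  M^T = M /\ forall x : 'cV[F]_n, x != 0 -> 0 < (x^T *m M *m x) 0 0.

Definition possemidefmx (F : realType) (n : nat) (M : 'M[F]_n) : Prop :=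
  M^T = M /\ forall x : 'cV[F]_n, 0 <= (x^T *m M *m x) 0 0.

(* The principal square root: for M positive semidefinite the set below is a
   singleton; the value is 0 when the set is empty. *)
Definition sqrtmx (F : realType) (n : nat) (M : 'M[F]_n) : 'M[F]_n :=
  xget 0 [set S : 'M[F]_n | possemidefmx S /\ S *m S = M].

(* The set of moduli is finite, so the supremum is a maximum when n > 0; it is 0
   when n = 0. [`|l|] lives in F[i], hence the projection to F. *)
Definition spectral_radius (F : realType) (n : nat) (M : 'M[F]_n) : F :=
  sup [set complex.Re `|l| | l in [set l : F[i] | eigenvalue (cmx M) l]].

(* Discrete-time (Schur) stabilizability. *)
Definition stabilizable (F : realType) (nx nu : nat)
    (A : 'M[F]_nx) (B : 'M[F]_(nx, nu)) : Prop :=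
  exists L : 'M[F]_(nu, nx), spectral_radius (A + B *m L) < 1.

Definition stabilizing_gains (F : realType) (nx nu ny : nat)
    (A : 'M[F]_nx) (B : 'M[F]_(nx, nu)) (C : 'M[F]_(ny, nx)) :
    set 'M[F]_(nu, ny) :=
  [set K | spectral_radius (A + B *m K *m C) < 1].

(* The nonnegative square roots of the eigenvalues of M^* M. When M has more
   columns than rows this adds at most the value 0 to the usual list, which does
   not change the largest one. *)
Definition singular_value (F : realType) (m n : nat) (M : 'M[F[i]]_(m, n))
    (s : F) : Prop :=
  0 <= s /\ eigenvalue (M^t* *m M) (s ^+ 2)%:C.

(* A maximum over a finite set (and 0 when n = 0). *)
Definition sigma_max (F : realType) (m n : nat) (M : 'M[F[i]]_(m, n)) : F :=
  sup [set s | singular_value M s].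

Definition expj (F : realType) (w : F) : F[i] := cos w +i* sin w.

Definition transfer_zw (F : realType) (nx nu nw ny : nat)
    (A : 'M[F]_nx) (B : 'M[F]_(nx, nu)) (Bw : 'M[F]_(nx, nw))
    (C : 'M[F]_(ny, nx)) (Q : 'M[F]_nx) (R : 'M[F]_nu)
    (K : 'M[F]_(nu, ny)) (w : F) : 'M[F[i]]_(nx + nu, nw) :=
  cmx (col_mx (sqrtmx Q) (sqrtmx R *m K *m C))
    *m invmx ((expj w)%:M - cmx (A + B *m K *m C)) *m cmx Bw.

(* For stabilizing K sigma_max of the transfer matrix is continuous in w, so the supremum over the
   compact interval is attained; for other K the value carries no meaning. *)
Definition hinf_cost (F : realType) (nx nu nw ny : nat)
    (A : 'M[F]_nx) (B : 'M[F]_(nx, nu)) (Bw : 'M[F]_(nx, nw))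
    (C : 'M[F]_(ny, nx)) (Q : 'M[F]_nx) (R : 'M[F]_nu)
    (K : 'M[F]_(nu, ny)) : F :=
  sup [set sigma_max (transfer_zw A B Bw C Q R K w) |
        w in [set w : F | 0 <= w <= 2 * pi]].

Definition hinf_sublevel (F : realType) (nx nu nw ny : nat)
    (A : 'M[F]_nx) (B : 'M[F]_(nx, nu)) (Bw : 'M[F]_(nx, nw))
    (C : 'M[F]_(ny, nx)) (Q : 'M[F]_nx) (R : 'M[F]_nu) (v : F) :
    set 'M[F]_(nu, ny) :=
  [set K | stabilizing_gains A B C K /\ hinf_cost A B Bw C Q R K <= v].

Definition frobenius_norm (F : realType) (m n : nat) (M : 'M[F]_(m, n)) : F :=
  Num.sqrt (\sum_(i < m) \sum_(j < n) M i j ^+ 2).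

(* Main.v *)
Require Import Defs.
From HB Require Import structures.
From mathcomp Require Import all_boot all_order all_algebra.
From mathcomp Require Import all_classical all_reals all_analysis.
From mathcomp Require Import complex.
From mathcomp Require Import ring lra.

Set Implicit Arguments.
Unset Strict Implicit.
Unset Printing Implicit Defensive.

Import Order.TTheory GRing.Theory Num.Theory.

Local Open Scope classical_set_scope.
Local Open Scope ring_scope.

(** The cost is a supremum of operator norms of T(K, w) = W(K) X(K, w)^-1 Bw,
where W(K) stacks Q^(1/2) over R^(1/2) K C and X(K, w) = e^(jw) I - (A + B K C).
Both W and X are affine in K, so along a segment K = s K0 + t K1 with s + t = 1
the resolvent identity gives an exact formula for the failure of convexity:
writing Gi for the inverse of X(Ki, w), and E = X(K0, w) - X(K1, w) = B (K1 - K0) C,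

    T(K) = s T(K0) + t T(K1)
           - s t [W(K0) G0 E + W(K1) - W(K0)] G1 E G Bw.

The last term is quadratic in K1 - K0 (convexity_defect). It remains to bound its
coefficients uniformly over the sublevel set J <= v: since Bw has a right inverse Y,
W(K) G = T(K) Y has norm at most v |Y|; and since Q^(1/2) is invertible, G is
recovered from the upper block of W(K) G, so that the resolvent is bounded too
(sublevel_state_map_bounded and sublevel_resolvent_bounded). Hence
J(K) <= s J(K0) + t J(K1) + s t k |K1 - K0|_F^2 with k independent of K0 and K1. As
s |K0|_F^2 + t |K1|_F^2 - |K|_F^2 = s t |K1 - K0|_F^2, adding m/2 |K|_F^2 with
m >= 2 k restores convexity.

Three facts support this computation. First, sigma_max, defined from the
eigenvalues of M^* M, is the operator norm (spectral theorem), hence subadditive and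
submultiplicative. Second, the frequency response of a stabilizing gain is bounded
on the unit circle, so that the supremum defining J does dominate every sigma_max:
the determinant of z - M is the product of the z - l over the eigenvalues l, hence
at least (1 - r)^n in modulus, and the adjugate has bounded entries. Third, a
positive definite matrix has a positive semidefinite square root. *)

(** * Euclidean norm of complex row vectors *)

Section RowNorm.
Variable F : realType.
Local Open Scope sesquilinear_scope.
Local Open Scope complex_scope.

(** The norm of F[i] takes values in F[i]; bounds and suprema live in F. *)
Definition modulus (z : F[i]) : F := complex.Re `|z|.

Lemma modulusE (z : F[i]) : (modulus z)%:C = `|z|.
Proof. by rewrite /modulus RRe_real ?normr_real. Qed.

Lemma modulus_ge0 (z : F[i]) : 0 <= modulus z.
Proof. by rewrite -ler0c modulusE. Qed.

Lemma modulus_real (x : F) : modulus x%:C = `|x|.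
Proof. by rewrite /modulus normc_def /= expr0n /= addr0 sqrtr_sqr. Qed.

(** The F-valued norm of the standard Hermitian product, whose values are in F[i]. *)
Definition rownorm n (x : 'rV[F[i]]_n) : F := complex.Re (sqrtC (dotmx x x)).

Lemma rownormE n (x : 'rV[F[i]]_n) : (rownorm x)%:C = sqrtC (dotmx x x).
Proof. by rewrite /rownorm RRe_real ?ger0_real ?sqrtC_ge0 ?dnorm_ge0. Qed.

Lemma rownorm_sqr n (x : 'rV[F[i]]_n) : (rownorm x ^+ 2)%:C = dotmx x x.
Proof. by rewrite rmorphXn /= rownormE sqrtCK. Qed.

Lemma rownorm_ge0 n (x : 'rV[F[i]]_n) : 0 <= rownorm x.
Proof. by rewrite -ler0c rownormE sqrtC_ge0 dnorm_ge0. Qed.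

Lemma rownorm_gt0 n (x : 'rV[F[i]]_n) : x != 0 -> 0 < rownorm x.
Proof. by move=> x0; rewrite -ltcR rownormE sqrtC_gt0 dnorm_gt0. Qed.

Lemma rownormD n (x y : 'rV[F[i]]_n) : rownorm (x + y) <= rownorm x + rownorm y.
Proof. by rewrite -lecR rmorphD /= !rownormE; exact: triangle_lerif. Qed.

Lemma rownormZ n a (x : 'rV[F[i]]_n) : rownorm (a *: x) = modulus a * rownorm x.
Proof.
apply: complexI; rewrite rmorphM /= !rownormE modulusE dnormZ.
by rewrite sqrtCM ?nnegrE ?exprn_ge0 ?dnorm_ge0// sqrCK.
Qed.

Lemma rownorm_sum_sqr n (x : 'rV[F[i]]_n) :
  rownorm x ^+ 2 = \sum_j modulus (x 0 j) ^+ 2.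
Proof.
apply: complexI; rewrite rownorm_sqr rmorph_sum /= dotmxE mxE.
by apply: eq_bigr => j _; rewrite !mxE rmorphXn /= modulusE normCK.
Qed.

Lemma CauchySchwarz_row n (x y : 'rV[F[i]]_n) :
  modulus ((x *m y^t*) 0 0) <= rownorm x * rownorm y.
Proof.
rewrite -lecR rmorphM /= modulusE !rownormE -dotmxE.
exact: CauchySchwarz_sqrt.
Qed.

End RowNorm.

(** * The largest singular value as an operator norm *)

Section OperatorNorm.
Variable F : realType.
Local Open Scope sesquilinear_scope.
Local Open Scope complex_scope.

(** Entry i of x M^* is the Hermitian product of x with row i of M, so this is
Cauchy-Schwarz applied row by row. Row vectors and M^* appear because eigenvectors
are row vectors here: x M^* M = s^2 x gives |x M^*| = s |x|. *)
Lemma row_mul_adj_le m n (M : 'M[F[i]]_(m, n)) (x : 'rV_n) :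
  rownorm (x *m M^t*) <=
  Num.sqrt (\sum_i \sum_j modulus (M i j) ^+ 2) * rownorm x.
Proof.
have S0 : 0 <= \sum_i \sum_j modulus (M i j) ^+ 2.
  by apply: sumr_ge0 => i _; apply: sumr_ge0 => j _; rewrite sqr_ge0.
rewrite -(@ler_pXn2r _ 2) ?nnegrE ?rownorm_ge0 ?mulr_ge0 ?sqrtr_ge0 ?rownorm_ge0//.
rewrite exprMn sqr_sqrtr// rownorm_sum_sqr mulr_suml.
apply: ler_sum => i _.
have -> : \sum_j modulus (M i j) ^+ 2 = rownorm (row i M) ^+ 2.
  by rewrite rownorm_sum_sqr; apply: eq_bigr => j _; rewrite mxE.
rewrite -exprMn ler_pXn2r ?nnegrE ?modulus_ge0 ?mulr_ge0 ?rownorm_ge0//.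
rewrite mulrC; apply: le_trans (CauchySchwarz_row _ _).
rewrite le_eqVlt; apply/orP; left; apply/eqP; congr modulus.
by rewrite !mxE; apply: eq_bigr => j _; rewrite !mxE.
Qed.

Lemma singular_value_le m n (M : 'M[F[i]]_(m, n)) c s : 0 <= c ->
  (forall x, rownorm (x *m M^t*) <= c * rownorm x) ->
  singular_value M s -> s <= c.
Proof.
move=> c0 Mc [s0 /eigenvalueP[x xM x0]].
have x_gt0 := rownorm_gt0 x0.
suff E : rownorm (x *m M^t*) = s * rownorm x by have := Mc x; rewrite E ler_pM2r.
apply/eqP; rewrite -(@eqrXn2 _ 2) ?mulr_ge0 ?rownorm_ge0//.
apply/eqP/complexI; rewrite exprMn [RHS]rmorphM /= !rownorm_sqr !dotmxE.
rewrite trmx_mul map_mxM trmxCK.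
by rewrite mulmxA -[x *m _ *m _]mulmxA xM -scalemxAl mxE.
Qed.

Lemma has_ubound_singular_value m n (M : 'M[F[i]]_(m, n)) :
  has_ubound [set s | singular_value M s].
Proof.
exists (Num.sqrt (\sum_i \sum_j modulus (M i j) ^+ 2)) => s /=.
by apply: singular_value_le; [exact: sqrtr_ge0 | exact: row_mul_adj_le].
Qed.

Lemma sigma_max_ge0 m n (M : 'M[F[i]]_(m, n)) : 0 <= sigma_max M.
Proof.
rewrite /sigma_max; have [[s Ms]|/nonemptyPn ->] := pselect ([set s | singular_value M s] !=set0).
  by apply: le_trans (ub_le_sup (has_ubound_singular_value M) Ms); case: Ms.
by rewrite sup0.
Qed.

Lemma sigma_max_le m n (M : 'M[F[i]]_(m, n)) c : 0 <= c ->
  (forall x, rownorm (x *m M^t*) <= c * rownorm x) -> sigma_max M <= c.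
Proof.
move=> c0 Mc; rewrite /sigma_max.
have [S0|/nonemptyPn ->] := pselect ([set s | singular_value M s] !=set0).
  by apply: ge_sup => // s /(singular_value_le c0 Mc).
by rewrite sup0.
Qed.

(** In an orthonormal eigenbasis P of M^* M the squared norm of x M^* is the sum of
the d_j |u_j|^2, where u = x P^* has the norm of x and d_j is the square of
|row j P *m M^*|, which is a singular value. *)
Lemma rownorm_sigma_max m n (M : 'M[F[i]]_(m, n)) (x : 'rV_n) :
  rownorm (x *m M^t*) <= sigma_max M * rownorm x.
Proof.
set N := M^t* *m M.
have Nherm : N \is hermsymmx.
  apply/is_hermitianmxP; rewrite expr0 scale1r /N trmx_mul map_mxM.
  by rewrite trmxCK.
have NE := orthomx_spectralP (hermitian_normalmx Nherm).
set P := spectralmx N in NE; set d := spectral_diag N in NE.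
have Pu : P \is unitarymx by exact: spectral_unitarymx.
have gramE k (y : 'rV[F[i]]_n) : (y *m M^t*) *m (k *m M^t*)^t* = y *m N *m k^t*.
  by rewrite trmx_mul map_mxM trmxCK /N !mulmxA.
have PN : P *m N = diag_mx d *m P.
  by rewrite NE !mulmxA mulmxV ?mul1mx// unitarymx_unit.
have rowPN j : row j P *m N = d 0 j *: row j P.
  by rewrite -row_mul PN; apply/rowP=> k; rewrite mul_diag_mx !mxE.
have rowP1 j : dotmx (row j P) (row j P) = 1.
  by have /row_unitarymxP/(_ j j) := Pu; rewrite eqxx.
have dE j : d 0 j = (rownorm (row j P *m M^t*) ^+ 2)%:C.
  rewrite rownorm_sqr dotmxE gramE rowPN -scalemxAl mxE -dotmxE rowP1.
  by rewrite mulr1.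
have d_le j : rownorm (row j P *m M^t*) <= sigma_max M.
  apply: (ub_le_sup (has_ubound_singular_value M)); split => /=.
    exact: rownorm_ge0.
  apply/eigenvalueP; exists (row j P); first by rewrite rowPN dE.
  apply/eqP => r0; have /esym/eqP := rowP1 j.
  by rewrite r0 linear0r oner_eq0.
rewrite -(@ler_pXn2r _ 2) ?nnegrE ?mulr_ge0 ?rownorm_ge0 ?sigma_max_ge0//.
rewrite exprMn; pose u := x *m P^t*.
have xE : x = u *m P by rewrite /u mulmxKtV.
have -> : rownorm x ^+ 2 = rownorm u ^+ 2.
  apply: complexI; rewrite !rownorm_sqr !dotmxE {1 2}xE trmx_mul map_mxM.
  by rewrite mulmxA mulmxtVK.
have -> : rownorm (x *m M^t*) ^+ 2 =
    \sum_j modulus (u 0 j) ^+ 2 * rownorm (row j P *m M^t*) ^+ 2.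
  apply: complexI; rewrite rownorm_sqr dotmxE gramE xE -[u *m P *m N]mulmxA PN.
  rewrite trmx_mul map_mxM !mulmxA mulmxtVK// mxE rmorph_sum /=.
  apply: eq_bigr => j _; rewrite mul_mx_diag !mxE rmorphM /= -dE.
  by rewrite rmorphXn /= modulusE normCK mulrC mulrCA mulrA.
rewrite [leRHS]mulrC rownorm_sum_sqr mulr_suml; apply: ler_sum => j _.
by rewrite ler_wpM2l ?sqr_ge0// lerXn2r ?nnegrE ?rownorm_ge0 ?sigma_max_ge0.
Qed.

Lemma sigma_maxM m n p (M : 'M[F[i]]_(m, n)) (N : 'M[F[i]]_(n, p)) :
  sigma_max (M *m N) <= sigma_max M * sigma_max N.
Proof.
apply: sigma_max_le => [|x]; first by rewrite mulr_ge0 ?sigma_max_ge0.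
rewrite trmx_mul map_mxM mulmxA -mulrA.
apply: le_trans (rownorm_sigma_max _ _) _.
by rewrite ler_wpM2l ?sigma_max_ge0 ?rownorm_sigma_max.
Qed.

Lemma sigma_maxM_le m n p (M : 'M[F[i]]_(m, n)) (N : 'M[F[i]]_(n, p)) a b :
  sigma_max M <= a -> sigma_max N <= b -> sigma_max (M *m N) <= a * b.
Proof.
move=> Ma Nb; apply: le_trans (sigma_maxM _ _) _.
by apply: ler_pM; rewrite ?sigma_max_ge0.
Qed.

Lemma sigma_maxD m n (M N : 'M[F[i]]_(m, n)) :
  sigma_max (M + N) <= sigma_max M + sigma_max N.
Proof.
apply: sigma_max_le => [|x]; first by rewrite addr_ge0 ?sigma_max_ge0.
rewrite linearD /= map_mxD mulmxDr mulrDl.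
by apply: le_trans (rownormD _ _) _; rewrite lerD ?rownorm_sigma_max.
Qed.

Lemma sigma_maxZ m n a (M : 'M[F[i]]_(m, n)) :
  sigma_max (a *: M) <= modulus a * sigma_max M.
Proof.
apply: sigma_max_le => [|x]; first by rewrite mulr_ge0 ?modulus_ge0 ?sigma_max_ge0.
rewrite linearZ /= map_mxZ -scalemxAr rownormZ -mulrA.
have -> : modulus (a^*)%R = modulus a by apply: complexI; rewrite !modulusE norm_conjC.
by rewrite ler_wpM2l ?modulus_ge0 ?rownorm_sigma_max.
Qed.

Lemma sigma_max_frobenius m n (M : 'M[F[i]]_(m, n)) :
  sigma_max M <= Num.sqrt (\sum_i \sum_j modulus (M i j) ^+ 2).
Proof. by apply: sigma_max_le; [exact: sqrtr_ge0|exact: row_mul_adj_le]. Qed.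

Lemma sigma_max_cmx m n (M : 'M[F]_(m, n)) : sigma_max (cmx M) <= frobenius_norm M.
Proof.
apply: le_trans (sigma_max_frobenius _) _; rewrite le_eqVlt; apply/orP; left.
apply/eqP; congr Num.sqrt; apply: eq_bigr => i _; apply: eq_bigr => j _.
by rewrite mxE modulus_real real_normK ?num_real.
Qed.

End OperatorNorm.

(** * Resolvents on the unit circle *)

Lemma norm_det_le (D : numDomainType) n (M : 'M[D]_n) (c : D) :
  (forall i j, `|M i j| <= c) -> `|\det M| <= n`!%:R * c ^+ n.
Proof.
move=> Mc; rewrite /determinant; apply: le_trans (ler_norm_sum _ _ _) _.
rewrite -perm.card_Sn mulr_natl -sumr_const.
apply: ler_sum => s _; rewrite normrM normrX normrN1 expr1n mul1r normr_prod.
have -> : c ^+ n = \prod_(i < n) c by rewrite prodr_const card_ord.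
by apply: ler_prod => i _; rewrite normr_ge0 Mc.
Qed.

Section Resolvent.
Variable F : realType.
Local Open Scope sesquilinear_scope.
Local Open Scope complex_scope.

Lemma ltr0c (x : F) : (0 < x%:C) = (0 < x).
Proof. exact: (ltcR 0). Qed.

Lemma eigenvalue_modulus_le n (M : 'M[F[i]]_n) l :
  eigenvalue M l -> modulus l <= sigma_max (M^t*).
Proof.
move=> /eigenvalueP[x xM /rownorm_gt0 x0].
rewrite -(ler_pM2r x0) -rownormZ -xM.
by have := rownorm_sigma_max (M^t*) x; rewrite trmxCK.
Qed.

(** The moduli of the eigenvalues are bounded by the operator norm, so the supremum
in the spectral radius is an upper bound and not a default value. *)
Lemma eigenvalue_le_spectral_radius n (M : 'M[F]_n) l :
  eigenvalue (cmx M) l -> modulus l <= spectral_radius M.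
Proof.
move=> Ml; apply: ub_le_sup; last by exists l.
by exists (sigma_max ((cmx M)^t*)) => _ [k /= Mk <-]; exact: eigenvalue_modulus_le.
Qed.

Lemma det_char_poly n (M : 'M[F[i]]_n) z : \det (z%:M - M) = (char_poly M).[z].
Proof.
rewrite /char_poly -horner_evalE -det_map_mx; congr (\det _).
apply/matrixP => i j; rewrite !mxE /= /horner_eval hornerD hornerN hornerC.
by rewrite hornerMn hornerX.
Qed.

(** Over the closed field F[i] the determinant is the product of the z - l over the
eigenvalues l, and each |z - l| is at least 1 - r. *)
Lemma det_resolvent_gap n (M : 'M[F[i]]_n) (r : F) : r < 1 ->
  (forall l, eigenvalue M l -> modulus l <= r) ->
  exists2 d : F, 0 < d & forall z, `|z| = 1 -> d%:C <= `|\det (z%:M - M)|.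
Proof.
move=> r1 Mr; have [s sE] := closed_field_poly_normal (char_poly M).
move: sE; rewrite (monicP (char_poly_monic M)) scale1r => sE.
exists ((1 - r) ^+ size s); first by rewrite exprn_gt0 ?subr_gt0.
move=> z z1; rewrite det_char_poly sE horner_prod normr_prod rmorphXn /=.
have -> : (1 - r)%:C ^+ size s = \prod_(l <- s) (1 - r)%:C.
  by rewrite big_const_seq count_predT iter_mulr_1.
rewrite big_seq [leRHS]big_seq; apply: ler_prod => l ls.
rewrite ler0c subr_ge0 (ltW r1) /= hornerXsubC.
have /Mr lr : eigenvalue M l by rewrite eigenvalue_root_char sE root_prod_XsubC.
apply: le_trans (lerB_dist _ _); rewrite z1 rmorphB /= lerD2l lerN2 -modulusE.
by rewrite lecR.
Qed.

Lemma resolvent_unit n (M : 'M[F[i]]_n) (r : F) : r < 1 ->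
  (forall l, eigenvalue M l -> modulus l <= r) ->
  forall z, `|z| = 1 -> z%:M - M \in unitmx.
Proof.
move=> r1 /(det_resolvent_gap r1)[d d0 dP] z /dP dz.
by rewrite unitmxE unitfE -normr_gt0 (lt_le_trans _ dz)// ltr0c.
Qed.

(** Cramer's rule: the determinant stays away from 0, and the entries of the adjugate
are minors of a matrix whose entries are bounded when |z| = 1. *)
Lemma resolvent_bounded n (M : 'M[F[i]]_n) (r : F) : r < 1 ->
  (forall l, eigenvalue M l -> modulus l <= r) ->
  exists c, forall z, `|z| = 1 -> sigma_max (invmx (z%:M - M)) <= c.
Proof.
move=> r1 Mr; have [d d0 dP] := det_resolvent_gap r1 Mr.
pose e : F[i] := 1 + \sum_i \sum_j `|M i j|.
(* b bounds the minors of z - M, whose entries are bounded by e *)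
pose b := complex.Re ((n.-1)`!%:R * e ^+ n.-1).
have e0 : 0 <= e by rewrite addr_ge0// sumr_ge0// => i _; rewrite sumr_ge0.
have bE : b%:C = (n.-1)`!%:R * e ^+ n.-1.
  by rewrite RRe_real// ger0_real// mulr_ge0 ?ler0n ?exprn_ge0.
have b0 : 0 <= b by rewrite -ler0c bE mulr_ge0 ?ler0n ?exprn_ge0.
have dC : 0 < d%:C by rewrite ltr0c.
exists (d^-1 * Num.sqrt (\sum_(i < n) \sum_(j < n) b ^+ 2)) => z z1.
rewrite /invmx (resolvent_unit r1 Mr z1).
apply: le_trans (sigma_maxZ _ _) _.
apply: ler_pM; rewrite ?modulus_ge0 ?sigma_max_ge0//.
  rewrite -lecR modulusE normfV fmorphV lef_pV2 ?posrE ?dP//.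
  exact: lt_le_trans dC (dP _ z1).
apply: le_trans (sigma_max_frobenius _) _.
apply: ler_wsqrtr; apply: ler_sum => i _; apply: ler_sum => j _.
rewrite lerXn2r ?nnegrE ?modulus_ge0// -lecR modulusE mxE normrM normrX normrN1.
rewrite expr1n mul1r bE; apply: norm_det_le => k l; rewrite !mxE.
apply: le_trans (ler_normB _ _) _; apply: lerD.
  by case: eqP => _; rewrite ?mulr1n ?z1// mulr0n normr0.
rewrite (bigD1 (lift j k)) //= (bigD1 (lift i l)) //= -addrA lerDl.
by rewrite addr_ge0 ?sumr_ge0// => p _; rewrite ?normr_ge0 ?sumr_ge0.
Qed.

End Resolvent.

(** * Square roots of positive definite matrices *)

Section SquareRoot.
Local Open Scope sesquilinear_scope.
Local Open Scope complex_scope.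

Lemma interpolation (K : fieldType) (f : K -> K) (s : seq K) :
  exists p : {poly K}, {in s, forall x, p.[x] = f x}.
Proof.
elim: s => [|a s [p pf]]; first by exists 0.
have [as_|as_] := boolP (a \in s).
  by exists p => x; rewrite inE => /predU1P[->|]; exact: pf.
pose q := \prod_(b <- s) ('X - b%:P).
have qa : q.[a] != 0 by rewrite -[_ == _]/(root q a) root_prod_XsubC.
exists (p + ((f a - p.[a]) / q.[a]) *: q) => x.
rewrite hornerD hornerZ inE => /predU1P[->|xs].
  by rewrite divfK// addrC subrK.
have /rootP -> : root q x by rewrite root_prod_XsubC.
by rewrite mulr0 addr0 pf.
Qed.

Lemma trmx_horner_mx (K : comNzRingType) n (M : 'M[K]_n.+1) p :
  M^T = M -> (horner_mx M p)^T = horner_mx M p.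
Proof.
move=> MT; elim/poly_ind: p => [|p c IH]; first by rewrite rmorph0 trmx0.
rewrite !(rmorphD, rmorphM) /= horner_mx_X horner_mx_C linearD /= tr_scalar_mx.
rewrite trmx_mul IH MT; congr (_ + _).
by apply/esym/comm_horner_mx.
Qed.

(** A real symmetric matrix is unitarily diagonalizable over F[i], with real
eigenvalues. Stating the consequence for real polynomials keeps the functional
calculus below inside real matrices. *)
Lemma symmetric_annihilator (F : realType) n (M : 'M[F]_n.+1) : M^T = M ->
  exists s : seq F, {in s, forall a, eigenvalue M a} /\
    forall p, {in s, forall a, p.[a] = 0} -> horner_mx M p = 0.
Proof.
move=> MT; have Nherm : cmx M \is hermsymmx.
  apply/is_hermitianmxP; rewrite expr0 scale1r; apply/matrixP => i j.
  by rewrite !mxE -[in LHS]MT mxE; apply/esym; exact: conjc_real.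
have NE := orthomx_spectralP (hermitian_normalmx Nherm).
have dR := hermitian_spectral_diag_real Nherm.
set P := spectralmx _ in NE; set d := spectral_diag _ in NE dR.
have Pu : P \in unitmx by exact: spectral_unit.
have dE j : (complex.Re (d 0 j))%:C = d 0 j.
  by rewrite RRe_real//; apply: (mxOverP dR).
exists [seq complex.Re (d 0 j) | j : 'I_n.+1]; split => [_ /mapP[j _ ->]|p p0].
  rewrite -(eigenvalue_map (real_complex F)) /= dE.
  apply/eigenvalueP; exists (row j P).
    rewrite -row_mul -/(cmx M) NE !mulmxA mulmxV// mul1mx.
    by apply/rowP => k; rewrite mul_diag_mx !mxE.
  apply/eqP => r0; have := Pu; rewrite unitmxE.
  by rewrite (expand_det_row P j) big1 ?unitr0// => k _;
     move/rowP/(_ k): r0; rewrite !mxE => ->; rewrite mul0r.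
apply: (@map_mx_inj _ _ (real_complex F)); rewrite map_horner_mx -/(cmx M) NE.
rewrite horner_mx_uconjC// horner_mx_diag raddf0.
suff -> : map_mx (horner (map_poly (real_complex F) p)) d = 0.
  by rewrite raddf0 mulmx0 mul0mx.
apply/rowP => j; rewrite !mxE -dE horner_map /= p0//.
by apply/mapP; exists j; rewrite ?mem_enum.
Qed.

Lemma posdefmx_eigenvalue_gt0 (F : realType) n (M : 'M[F]_n) a :
  posdefmx M -> eigenvalue M a -> 0 < a.
Proof.
move=> [_ Mpos] /eigenvalueP[x xM x0].
have := Mpos x^T; rewrite trmx_eq0 trmxK xM -scalemxAl mxE => /(_ x0).
have -> : (x *m x^T) 0 0 = \sum_j x 0 j ^+ 2.
  by rewrite mxE; apply: eq_bigr => j _; rewrite mxE expr2.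
move=> ax; rewrite ltNge; apply: contraTN ax => a0.
by rewrite -leNgt mulr_le0_ge0// sumr_ge0// => j _; rewrite sqr_ge0.
Qed.

(** The root is T^2, where T = q(M) and q interpolates the fourth root on the
eigenvalues of M: T is symmetric, so T^2 is positive semidefinite, and q^4 - X
vanishes on the eigenvalues, so T^4 = M. *)
Lemma sqrtmx_posdef (F : realType) n (M : 'M[F]_n) : posdefmx M ->
  sqrtmx M *m sqrtmx M = M.
Proof.
move=> Mpos; suff [S SP] : exists S, possemidefmx S /\ S *m S = M.
  by rewrite /sqrtmx; case: xgetP => [_ _ []//|/(_ S)].
case: n M Mpos => [|n] M Mpos.
  exists 0; split; last by rewrite [M]flatmx0 mul0mx.
  by split=> [|x]; rewrite ?trmx0// mulmx0 mul0mx mxE.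
have [s [sM sP]] := symmetric_annihilator Mpos.1.
have [q qP] := interpolation (fun a => Num.sqrt (Num.sqrt a)) s.
pose T := horner_mx M q.
have TT : T^T = T by apply: trmx_horner_mx; exact: Mpos.1.
exists (T *m T); split; last first.
  apply/eqP; rewrite -subr_eq0.
  have -> : T *m T *m (T *m T) - M = horner_mx M (q * q * (q * q) - 'X).
    by rewrite rmorphB !rmorphM /= horner_mx_X.
  apply/eqP/sP => a /[dup] /qP qa /sM Ma.
  have a0 := posdefmx_eigenvalue_gt0 Mpos Ma.
  rewrite !hornerE /= qa -mulrA -!expr2 !sqr_sqrtr ?sqrtr_ge0 ?(ltW a0)//.
  by rewrite subrr.
split=> [|x]; first by rewrite trmx_mul TT.
have -> : x^T *m (T *m T) *m x = (T *m x)^T *m (T *m x).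
  by rewrite trmx_mul TT !mulmxA.
by rewrite mxE sumr_ge0// => i _; rewrite mxE -expr2 sqr_ge0.
Qed.

Lemma posdefmx_unit (F : realType) n (M : 'M[F]_n) : posdefmx M -> M \in unitmx.
Proof.
move=> Mpos; rewrite -row_free_unit -kermx_eq0; apply/rowV0P => x /sub_kermxP xM.
apply/eqP; apply: contraT => x0; have := Mpos.2 x^T.
by rewrite trmx_eq0 trmxK xM mul0mx mxE ltxx => /(_ x0).
Qed.

Lemma sqrtmx_unit (F : realType) n (M : 'M[F]_n) :
  posdefmx M -> sqrtmx M \in unitmx.
Proof.
move=> Mpos; have := posdefmx_unit Mpos.
by rewrite -{1}(sqrtmx_posdef Mpos) unitmx_mul => /andP[].
Qed.

End SquareRoot.

(** * Failure of convexity of a transfer function *)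

Lemma resolventB (K : comUnitRingType) n (X Y : 'M[K]_n) :
  X \in unitmx -> Y \in unitmx ->
  invmx Y - invmx X = invmx X *m (X - Y) *m invmx Y.
Proof. by move=> Xu Yu; rewrite mulmxBr mulmxBl mulVmx// mul1mx mulmxK. Qed.

(** Comparing the inverse at the intermediate point with the inverses at both ends by
the resolvent identity leaves s t (W0 X0^-1 - W1 X1^-1) (X0 - X1) X^-1, and a second
use of the identity makes the first factor linear in X0 - X1 and W1 - W0. *)
Lemma convexity_defect (K : comUnitRingType) p n q (W0 W1 : 'M[K]_(p, n))
    (X0 X1 : 'M[K]_n) (Y : 'M[K]_(n, q)) (s t : K) : s + t = 1 ->
  X0 \in unitmx -> X1 \in unitmx -> s *: X0 + t *: X1 \in unitmx ->
  (s *: W0 + t *: W1) *m invmx (s *: X0 + t *: X1) *m Y =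
  s *: (W0 *m invmx X0 *m Y) + t *: (W1 *m invmx X1 *m Y) -
  (s * t) *: ((W0 *m invmx X0 *m (X0 - X1) + (W1 - W0)) *m invmx X1
     *m (X0 - X1) *m invmx (s *: X0 + t *: X1) *m Y).
Proof.
move=> st1 X0u X1u Xu; set X := s *: X0 + t *: X1; set E := X0 - X1.
have sE : s = 1 - t by rewrite -st1 addrK.
have XE0 : X0 - X = t *: E.
  by rewrite /X sE scalerBl scale1r /E scalerBr -addrA opprD addNKr opprD opprK.
have XE1 : X1 - X = - s *: E.
  have tE : t = 1 - s by rewrite -st1 addrC addKr.
  by rewrite /X tE scalerBl scale1r addrCA opprD addNKr /E scaleNr scalerBr.
have G0 : invmx X = invmx X0 + t *: (invmx X0 *m E *m invmx X).
  by rewrite -[LHS](subrK (invmx X0)) resolventB// XE0 -scalemxAr -scalemxAl addrC.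
have G1 : invmx X = invmx X1 - s *: (invmx X1 *m E *m invmx X).
  rewrite -[LHS](subrK (invmx X1)) resolventB// XE1 -scalemxAr -scalemxAl addrC.
  by rewrite scaleNr.
have D : (W0 *m invmx X0 *m E + (W1 - W0)) *m invmx X1 =
    W1 *m invmx X1 - W0 *m invmx X0.
  rewrite mulmxDl -!mulmxA [invmx X0 *m _]mulmxA -resolventB// mulmxBl mulmxBr.
  by rewrite addrC addrA subrK.
have W0G : W0 *m invmx X = W0 *m invmx X0 + t *: (W0 *m invmx X0 *m E *m invmx X).
  by rewrite {1}G0 mulmxDr -scalemxAr !mulmxA.
have W1G : W1 *m invmx X = W1 *m invmx X1 - s *: (W1 *m invmx X1 *m E *m invmx X).
  by rewrite {1}G1 mulmxBr -scalemxAr !mulmxA.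
rewrite D !scalemxAl -mulmxDl -mulmxBl; congr (_ *m Y).
rewrite mulmxDl -!scalemxAl W0G W1G !mulmxBl !scalerBr scalerDr.
by rewrite !scalerA [t * s]mulrC opprB addrACA.
Qed.

(** * Uniform bounds on a sublevel set of the cost *)

Section HinfCost.
Variable F : realType.
Local Open Scope complex_scope.

Lemma norm_expj (w : F) : `|expj w| = 1.
Proof. by rewrite normc_def /= cos2Dsin2 sqrtr1. Qed.

Lemma cmxM m n p (M : 'M[F]_(m, n)) (N : 'M[F]_(n, p)) :
  cmx (M *m N) = cmx M *m cmx N.
Proof. exact: map_mxM. Qed.

Lemma frobenius_norm_sqr m n (M : 'M[F]_(m, n)) :
  frobenius_norm M ^+ 2 = \sum_(i < m) \sum_(j < n) M i j ^+ 2.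
Proof.
by rewrite sqr_sqrtr// sumr_ge0// => i _; rewrite sumr_ge0// => j _; rewrite sqr_ge0.
Qed.

Lemma frobenius_norm_conv m n (M N : 'M[F]_(m, n)) (s t : F) : s + t = 1 ->
  frobenius_norm (s *: M + t *: N) ^+ 2 =
  s * frobenius_norm M ^+ 2 + t * frobenius_norm N ^+ 2
  - s * t * frobenius_norm (N - M) ^+ 2.
Proof.
move=> st1; have -> : s = 1 - t by rewrite -st1 addrK.
rewrite !frobenius_norm_sqr !mulr_sumr -sumrN -!big_split /=.
apply: eq_bigr => i _; rewrite !mulr_sumr -sumrN -!big_split /=.
by apply: eq_bigr => j _; rewrite !mxE; ring.
Qed.

Variables (nx nu nw ny : nat).
Variables (A : 'M[F]_nx) (B : 'M[F]_(nx, nu)) (Bw : 'M[F]_(nx, nw)).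
Variables (C : 'M[F]_(ny, nx)) (Q : 'M[F]_nx) (R : 'M[F]_nu).

Let W K := cmx (col_mx (sqrtmx Q) (sqrtmx R *m K *m C)).
Let X K w := (expj w)%:M - cmx (A + B *m K *m C).

Lemma stabilizing_pencil_unit K w : stabilizing_gains A B C K -> X K w \in unitmx.
Proof.
move=> Kst; apply: (resolvent_unit Kst); last exact: norm_expj.
by move=> l; exact: eigenvalue_le_spectral_radius.
Qed.

(** The content is that the frequency response is bounded: the supremum of an
unbounded set is 0. *)
Lemma sigma_max_le_hinf_cost K w : stabilizing_gains A B C K -> 0 <= w <= 2 * pi ->
  sigma_max (transfer_zw A B Bw C Q R K w) <= hinf_cost A B Bw C Q R K.
Proof.
move=> Kst w02; apply: ub_le_sup; last by exists w.
have [|c cP] := @resolvent_bounded F _ (cmx (A + B *m K *m C)) _ Kst.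
  by move=> l; exact: eigenvalue_le_spectral_radius.
exists (sigma_max (W K) * c * sigma_max (cmx Bw)) => _ [u _ <-].
apply: sigma_maxM_le => //; apply: sigma_maxM_le => //.
by apply: cP; exact: norm_expj.
Qed.

Lemma hinf_cost_le K c :
  (forall w, 0 <= w <= 2 * pi -> sigma_max (transfer_zw A B Bw C Q R K w) <= c) ->
  hinf_cost A B Bw C Q R K <= c.
Proof.
move=> Kc; apply: ge_sup => [|_ [w /= wP <-]]; last exact: Kc.
by eexists; exists 0 => //=; rewrite lexx mulr_ge0// pi_ge0.
Qed.

Hypotheses (hBw : row_free Bw) (hQ : posdefmx Q).
Variable v : F.
Hypothesis hv : 0 < v.

(** A right inverse of Bw turns the bound on the transfer function into one on the map
from state disturbances to outputs. *)
Lemma sublevel_state_map_bounded : exists2 a : F, 0 <= a &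
  forall K w, hinf_sublevel A B Bw C Q R v K -> 0 <= w <= 2 * pi ->
    sigma_max (W K *m invmx (X K w)) <= a.
Proof.
have /row_freeP[Y BwY] := hBw.
exists (v * sigma_max (cmx Y)); first by rewrite mulr_ge0 ?sigma_max_ge0// ltW.
move=> K w [Kst Kv] wP.
have -> : W K *m invmx (X K w) = transfer_zw A B Bw C Q R K w *m cmx Y.
  by rewrite /transfer_zw -[RHS]mulmxA -cmxM BwY /cmx map_mx1 mulmx1.
apply: sigma_maxM_le => //; exact: le_trans (sigma_max_le_hinf_cost Kst wP) Kv.
Qed.

(** The upper block of W(K) is Q^(1/2), so L is a left inverse of W(K) that does not
depend on K. *)
Lemma sublevel_resolvent_bounded : exists2 g : F, 0 <= g &
  forall K w, hinf_sublevel A B Bw C Q R v K -> 0 <= w <= 2 * pi ->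
    sigma_max (invmx (X K w)) <= g.
Proof.
have [a a0 aP] := sublevel_state_map_bounded.
pose L : 'M[F]_(nx, nx + nu) := row_mx (invmx (sqrtmx Q)) 0.
exists (sigma_max (cmx L) * a); first by rewrite mulr_ge0 ?sigma_max_ge0.
move=> K w KV wP.
have -> : invmx (X K w) = cmx L *m (W K *m invmx (X K w)).
  rewrite mulmxA -cmxM mul_row_col mul0mx addr0 mulVmx ?sqrtmx_unit//.
  by rewrite /cmx map_mx1 mul1mx.
by apply: sigma_maxM_le => //; exact: aP.
Qed.

(** At each frequency the defect of T is a product in which K1 - K0 occurs twice and
the other factors are bounded uniformly on the sublevel set; the supremum over
frequencies keeps the inequality. *)
Lemma sublevel_convexity_defect : exists2 k : F, 0 <= k &
  forall K0 K1 s t, 0 <= s -> 0 <= t -> s + t = 1 ->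
    hinf_sublevel A B Bw C Q R v K0 -> hinf_sublevel A B Bw C Q R v K1 ->
    hinf_sublevel A B Bw C Q R v (s *: K0 + t *: K1) ->
    hinf_cost A B Bw C Q R (s *: K0 + t *: K1) <=
      s * hinf_cost A B Bw C Q R K0 + t * hinf_cost A B Bw C Q R K1
      + s * t * (k * frobenius_norm (K1 - K0) ^+ 2).
Proof.
have [a a0 aP] := sublevel_state_map_bounded.
have [g g0 gP] := sublevel_resolvent_bounded.
(* the norms are generalized to variables, since unification would unfold the
   suprema that define them *)
have opaque (z : F) : 0 <= z -> exists2 y, 0 <= y & y = z by exists z.
have [b b0 bE] := opaque _ (sigma_max_ge0 (cmx B)).
have [c c0 cE] := opaque _ (sigma_max_ge0 (cmx C)).
have [r r0 rE] := opaque _ (sigma_max_ge0 (cmx (col_mx (0 : 'M[F]_(nx, nu)) (sqrtmx R)))).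
have [q q0 qE] := opaque _ (sigma_max_ge0 (cmx Bw)).
exists ((a * (b * c) + r * c) * g * (b * c) * g * q).
  by rewrite !mulr_ge0// addr_ge0// !mulr_ge0.
move=> K0 K1 s t s0 t0 st1 V0 V1 V; set K := s *: K0 + t *: K1.
have [d d0 dE] : exists2 d, 0 <= d & d = frobenius_norm (K1 - K0).
  by apply: opaque; exact: sqrtr_ge0.
have sandwich m (M : 'M[F]_(m, nu)) : sigma_max (cmx (M *m (K1 - K0) *m C)) <=
    sigma_max (cmx M) * d * c.
  rewrite !cmxM cE; apply: sigma_maxM_le => //.
  by apply: sigma_maxM_le => //; rewrite dE sigma_max_cmx.
apply: hinf_cost_le => w wP.
have sC : s%:C + t%:C = 1 by rewrite -rmorphD st1.
have WE : W K = s%:C *: W K0 + t%:C *: W K1.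
  rewrite /W /cmx -!map_mxZ -map_mxD !scale_col_mx add_col_mx; congr map_mx.
  rewrite -scalerDl st1 scale1r; congr col_mx.
  by rewrite mulmxDr mulmxDl -!scalemxAr -!scalemxAl.
have XE : X K w = s%:C *: X K0 w + t%:C *: X K1 w.
  rewrite /X !scalerBr addrACA -opprD -scalerDl sC scale1r; congr (_ - _).
  rewrite /cmx -!map_mxZ -map_mxD; congr map_mx.
  rewrite !scalerDr addrACA -scalerDl st1 scale1r; congr (_ + _).
  by rewrite mulmxDr mulmxDl -!scalemxAr -!scalemxAl.
have WB : W K1 - W K0 = cmx (col_mx 0 (sqrtmx R) *m (K1 - K0) *m C).
  rewrite /W /cmx -map_mxB opp_col_mx add_col_mx subrr !mul_col_mx !mul0mx.
  by rewrite mulmxBr mulmxBl.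
have XB : X K0 w - X K1 w = cmx (B *m (K1 - K0) *m C).
  rewrite /X opprB addrC addrA subrK /cmx -map_mxB.
  by congr map_mx; rewrite mulmxBr mulmxBl opprD addrACA subrr add0r.
have Xu : s%:C *: X K0 w + t%:C *: X K1 w \in unitmx.
  by rewrite -XE stabilizing_pencil_unit//; case: V.
have := convexity_defect (W K0) (W K1) (cmx Bw) sC (stabilizing_pencil_unit w V0.1)
  (stabilizing_pencil_unit w V1.1) Xu.
rewrite -WE -XE WB XB => TE.
rewrite {1}/transfer_zw -/(W K) -/(X K w) TE.
apply: le_trans (sigma_maxD _ _) _; refine (lerD _ _).
  apply: le_trans (sigma_maxD _ _) _; refine (lerD _ _).
    apply: le_trans (sigma_maxZ _ _) _; rewrite modulus_real ger0_norm//.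
    by rewrite ler_wpM2l//; exact: sigma_max_le_hinf_cost V0.1 wP.
  apply: le_trans (sigma_maxZ _ _) _; rewrite modulus_real ger0_norm//.
  by rewrite ler_wpM2l//; exact: sigma_max_le_hinf_cost V1.1 wP.
rewrite -scaleNr -rmorphM -rmorphN; apply: le_trans (sigma_maxZ _ _) _.
rewrite modulus_real normrN ger0_norm ?mulr_ge0// ler_wpM2l ?mulr_ge0//.
rewrite -dE.
have -> : (a * (b * c) + r * c) * g * (b * c) * g * q * d ^+ 2 =
  (a * (b * d * c) + r * d * c) * g * (b * d * c) * g * q by ring.
rewrite bE rE qE.
apply: sigma_maxM_le => //; apply: sigma_maxM_le; last exact: gP.
apply: sigma_maxM_le; last exact: sandwich.
apply: sigma_maxM_le; last exact: gP.
apply: le_trans (sigma_maxD _ _) _; apply: lerD; last exact: sandwich.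
by apply: sigma_maxM_le; [exact: aP | exact: sandwich].
Qed.

End HinfCost.

(** * Weak convexity of the cost *)

Theorem theorem1 (F : realType) (nx nu nw ny : nat)
    (A : 'M[F]_nx) (B : 'M[F]_(nx, nu)) (Bw : 'M[F]_(nx, nw))
    (C : 'M[F]_(ny, nx)) (Q : 'M[F]_nx) (R : 'M[F]_nu)
    (hAB : stabilizable A B)
    (hBw : row_free Bw) (hC : row_free C)
    (hQ : posdefmx Q) (hR : posdefmx R)
    (hK : stabilizing_gains A B C !=set0)
    (v : F) (hv : 0 < v)
    (hKv : hinf_sublevel A B Bw C Q R v !=set0) :
  exists m : F, 0 < m /\
    forall V : set 'M[F]_(nu, ny),
      V !=set0 -> convex_set V -> V `<=` hinf_sublevel A B Bw C Q R v ->
      convex_function V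
        (fun K => hinf_cost A B Bw C Q R K + m / 2 * frobenius_norm K ^+ 2).
Proof.
have [k k0 kP] := sublevel_convexity_defect A B C R hBw hQ hv.
(* the extra 1 only keeps m positive when k = 0 *)
exists (2 * k + 1); split; first by rewrite ltr_wpDl// mulr_ge0.
move=> V _ convV VS x K0 K1 V0 V1.
have V01 := convV K0 K1 x V0 V1.
rewrite !inE in V0 V1 V01.
rewrite convRE.
have convE : conv x K0 K1 = x%:num *: K0 + (1 - x%:num) *: K1 by [].
rewrite convE in V01 *.
have s0 : 0 <= x%:num by [].
have t0 : 0 <= 1 - x%:num by rewrite subr_ge0.
have st1 : x%:num + (1 - x%:num) = 1 by rewrite addrC subrK.
rewrite /unstable.onem.
move: (x%:num) (1 - x%:num) s0 t0 st1 V01 {convE} => s t s0 t0 st1 V01.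
have := kP K0 K1 s t s0 t0 st1 (VS _ V0) (VS _ V1) (VS _ V01).
rewrite frobenius_norm_conv//.
set J := hinf_cost _ _ _ _ _ _ _.
have := mulr_ge0 (mulr_ge0 s0 t0) (sqr_ge0 (frobenius_norm (K1 - K0))).
set D := frobenius_norm (K1 - K0) ^+ 2.
move: (hinf_cost _ _ _ _ _ _ K0) (hinf_cost _ _ _ _ _ _ K1) => J0 J1.
set N0 := frobenius_norm K0 ^+ 2; set N1 := frobenius_norm K1 ^+ 2.
(* after cancellation, s t |K1 - K0|_F^2 / 2 >= 0 remains *)
nra.
Qed.
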